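(* Let $\mathcal{P}=\{\mathbb{P}_{\boldsymbol\theta}:\boldsymbol\theta\in\boldsymbol\Theta\}$ with $\boldsymbol\Theta\subseteq\mathbb{R}^p$ be a parametric family and $\mathcal{M}$ an estimation scheme satisfying the uniform tail assumption (stated in the context) with constants $C_1,C_2,\gamma>0$ and $r(n)=n^\kappa$, where $\kappa\ge\gamma/2$, and also the bias assumption (stated in the context) with exponent $\rho>0$. Let $(\widehat{\boldsymbol\theta}_t)_{t\ge1}$ be the recursive training process (defined in the context) with ground truth $\boldsymbol\theta^\star\in\boldsymbol\Theta$, initial sample size $n$ and schedule $(c_t)_{t\ge1}$. Then for every $\delta>0$: (1) (Small bias) If $\rho\ge1$, then for $c_t=t^{1+s}$ with any $s>0$, $$\lim_{n\to\infty}\lim_{T\to\infty}\mathbb{P}\big(\|\widehat{\boldsymbol\theta}_T-\boldsymbol\theta^\star\|_2\ge\delta\big)=0.$$ (2) (Large bias) If $\frac{\kappa}{\gamma}\le\rho<1$, then $$\lim_{n\to\infty}\lim_{T\to\infty}\mathbb{P}\big(\|\widehat{\boldsymbol\theta}_T-\boldsymbol\theta^\star\|_2\ge\delta\big)=\begin{cases}0,&\text{if } c_t=t^{1+s}\text{ with } s>\frac1\rho-1,\\[2pt] 1,&\text{if } c_t=t^{1+s}\text{ with } 0<s<\frac1\rho-1.\end{cases}$$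
   Context: Estimation scheme: $\mathcal{M}$ maps any finite dataset of points of the sample space $\mathcal{X}$ to an element of $\boldsymbol\Theta$. Recursive (fully synthetic) training: $\mathcal{D}_0$ consists of $n_0=n$ i.i.d. draws from $\mathbb{P}_{\boldsymbol\theta^\star}$; $\widehat{\boldsymbol\theta}_{t+1}=\mathcal{M}(\mathcal{D}_t)$ for all $t\ge0$; and for $t\ge1$, conditionally on the past, $\mathcal{D}_t$ consists of $n_t=c_t\, n$ i.i.d. draws from $\mathbb{P}_{\widehat{\boldsymbol\theta}_t}$ (if $c_tn$ is not an integer, $n_t=\lceil c_tn\rceil$). Uniform tail assumption: there are constants $C_1,C_2,\gamma>0$ and a positive diverging sequence $r(n)$ such that for all $n\ge1$ and all $\delta>0$, $$\sup_{\boldsymbol\theta\in\boldsymbol\Theta}\mathbb{P}\big(\|\widehat{\boldsymbol\theta}-\boldsymbol\theta\|_2\ge\delta\big)\le C_1\exp(-C_2\,r(n)\,\delta^\gamma),$$ where $\widehat{\boldsymbol\theta}=\mathcal{M}(\mathcal{D})$ and $\mathcal{D}$ consists of $n$ i.i.d. draws from $\mathbb{P}_{\boldsymbol\theta}$. Bias assumption with exponent $\rho$: there are positive constants $\rho$ and $v_1,\dots,v_p$ ($v_i$ depending only on the coordinate $i$) such that for every $i\in\{1,\dots,p\}$ and $\boldsymbol\theta\in\boldsymbol\Theta$, with $\widehat{\boldsymbol\theta}=\mathcal{M}(\mathcal{D})$ and $\mathcal{D}$ consisting of $n$ i.i.d. draws from $\mathbb{P}_{\boldsymbol\theta}$, $|\mathbb{E}(\widehat\theta_i)-\theta_i|\asymp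 \frac{v_i}{n^\rho}$. Here $a\asymp b$ means $c\,b\le a\le C\,b$ for constants $0<c\le C<\infty$ not depending on $n$ or $\boldsymbol\theta$.
   Formalization: In the limit-1 case, some coordinate's bias is also assumed to have a sign independent of θ and n (otherwise biases can cancel and the claim fails); the limits equal to 0 use limsup over T, since the inner limit in T need not exist. *)

(* Defs.v *)
From HB Require Import structures.
From mathcomp Require Export all_boot all_order all_algebra.
From mathcomp Require Export all_classical all_reals all_analysis.
From mathcomp Require Export measurable_realfun.
Export Order.TTheory GRing.Theory Num.Theory.
Export numFieldNormedType.Exports.

Set Implicit Arguments.
Unset Strict Implicit.
Unset Printing Implicit Defensive.

Local Open Scope classical_set_scope.
Local Open Scope ring_scope.

(* The library norm on row vectors is the sup norm. *)
Definition l2norm (R : realType) (p : nat) (v : 'rV[R]_p) : R :=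
  Num.sqrt (\sum_(i < p) v ord0 i ^+ 2)%R.

Section iid.
Context d (X : measurableType d) (R : realType) (mu : probability X R).

Definition tuple_cons m (xt : X * m.-tuple X) : m.+1.-tuple X :=
  [tuple of xt.1 :: xt.2].

Lemma measurable_tuple_cons m : measurable_fun setT (@tuple_cons m).
Proof. exact: measurable_cons. Qed.

HB.instance Definition _ m := isMeasurableFun.Build _ _ _ _ (@tuple_cons m)
  (@measurable_tuple_cons m).

Section prod_prob.
Local Open Scope ereal_scope.
Context d' (Y : measurableType d') (nu : probability Y R).

Definition prod_prob : set (X * Y)%type -> \bar R := mu \x nu.

HB.instance Definition _ := Measure.on prod_prob.

Lemma prod_prob_setT : prod_prob setT = 1.
Proof.
rewrite /prod_prob -setXTT product_measure1E//.
by rewrite -[RHS]mule1; congr (_ * _); exact: probability_setT.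
Qed.

HB.instance Definition _ :=
  Measure_isProbability.Build _ _ _ prod_prob prod_prob_setT.
End prod_prob.

(* The law of m i.i.d. draws from mu, i.e. the m-fold product of mu. *)
Fixpoint iid (m : nat) : probability (m.-tuple X) R :=
  match m with
  | 0 => dirac ([tuple] : 0.-tuple X)
  | k.+1 => distribution (prod_prob (iid k)) (@tuple_cons k)
  end.

End iid.

Section estimation.
Context (R : realType) (p : nat) (dX : measure_display) (X : measurableType dX).
Variables (Theta : set 'rV[R]_p) (P : 'rV[R]_p -> probability X R)
  (M : seq X -> 'rV[R]_p).

(* The family is {P theta | theta in Theta}; the values of P outside Theta play
   no role. A finite dataset is a sequence of sample points. *)
Definition estimation_scheme : Prop :=
  (forall D : seq X, Theta (M D)) /\
  (forall (m : nat) (i : 'I_p),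
     measurable_fun setT (fun D : m.-tuple X => M D ord0 i)).

Definition uniform_tail (C1 C2 gamma : R) (r : nat -> R) : Prop :=
  [/\ 0 < C1, 0 < C2 & 0 < gamma] /\
  [/\ forall n : nat, (0 < n)%N -> 0 < r n,
      r n @[n --> \oo] --> +oo%R &
      forall (n : nat) (delta : R), (0 < n)%N -> 0 < delta ->
        (ereal_sup [set iid (P theta) n
                         [set D : n.-tuple X | (delta <= l2norm (M D - theta))%R]
                  | theta in Theta]
        <= (C1 * expR (- (C2 * r n * delta `^ gamma)))%:E)%E].

Definition bias (theta : 'rV[R]_p) (n : nat) (i : 'I_p) : \bar R :=
  ('E_(iid (P theta) n)[fun D : n.-tuple X => M D ord0 i] - (theta ord0 i)%:E)%E.

Definition bias_assumption (rho : R) : Prop :=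
  0 < rho /\
  exists v : 'I_p -> R, (forall i, 0 < v i) /\
  forall i, exists c C : R, 0 < c <= C /\
  forall (theta : 'rV[R]_p) (n : nat), Theta theta -> (0 < n)%N ->
    ((c * (v i / n%:R `^ rho))%:E <= `|bias theta n i|
                                  <= (C * (v i / n%:R `^ rho))%:E)%E.

(* bias_assumption controls the absolute value of the bias only: its sign may
   still change with theta, e.g. point towards a fixed parameter, in which case
   the biases of successive steps cancel instead of adding up. *)
Definition one_signed_bias (i : 'I_p) : Prop :=
  (forall (theta : 'rV[R]_p) (n : nat), Theta theta -> (0 < n)%N ->
     (0 <= bias theta n i)%E) \/
  (forall (theta : 'rV[R]_p) (n : nat), Theta theta -> (0 < n)%N ->
     (bias theta n i <= 0)%E).

End estimation.

Definition sample_size (R : realType) (n : nat) (c : nat -> R) (t : nat) : nat :=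
  if t is 0%N then n else `|Num.ceil (c t * n%:R)|%N.

Definition power_schedule (R : realType) (s : R) (t : nat) : R :=
  t%:R `^ (1 + s).

(* g is a version of the conditional probability of A given the sub-sigma-algebra
   F. *)
Definition cond_prob_version (R : realType) (d : measure_display)
    (Omega : measurableType d) (Q : probability Omega R)
    (F : set_system Omega) (A : set Omega) (g : Omega -> \bar R) : Prop :=
  (forall Y : set (\bar R), measurable Y -> F (g @^-1` Y)) /\
  (forall E : set Omega, F E -> Q (E `&` A) = (\int[Q]_(w in E) g w)%E).

Section recursion.
Context (R : realType) (p : nat) (dX : measure_display) (X : measurableType dX).
Variables (P : 'rV[R]_p -> probability X R) (M : seq X -> 'rV[R]_p)
  (theta_star : 'rV[R]_p).
Context (d : measure_display) (Omega : measurableType d)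
  (Q : probability Omega R).
Variables (size : nat -> nat) (D : forall t : nat, Omega -> (size t).-tuple X).

(* With the convention that the 0-th estimate is theta_star, the dataset D t is
   drawn from P (theta_hat t) for every t, including t = 0. *)
Definition theta_hat (t : nat) (w : Omega) : 'rV[R]_p :=
  if t is u.+1 then M (D u w) else theta_star.

Definition past (t : nat) : set_system Omega :=
  <<s [set A | exists u (B : set ((size u).-tuple X)),
         [/\ (u < t)%N, measurable B & A = D u @^-1` B]] >>.

Definition recursive_training : Prop :=
  (forall t, measurable_fun setT (D t)) /\
  (forall t (B : set ((size t).-tuple X)), measurable B ->
     cond_prob_version Q (past t) (D t @^-1` B)
       (fun w => iid (P (theta_hat t w)) (size t) B)).

End recursion.

Definition iterated_lim (R : realType) (u : nat -> nat -> \bar R)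
    (l : \bar R) : Prop :=
  exists L : nat -> \bar R,
    (\forall n \near \oo, u n T @[T --> \oo] --> L n) /\
    L n @[n --> \oo] --> l.

(* Iterated limit 0 of a nonnegative u, with an upper inner limit. A probability
   P (delta <= norm (theta_hat T - theta_star)) need not converge in T: the
   limit of theta_hat may charge the sphere of radius delta around theta_star,
   with theta_hat crossing this sphere infinitely often. *)
Definition iterated_lim0 (R : realType) (u : nat -> nat -> \bar R) : Prop :=
  limn_esup (u n) @[n --> \oo] --> 0%E.

(* Main.v *)
(* Fix a coordinate X_t of the t-th estimate. The tail assumption with
   kappa >= gamma / 2 bounds the conditional second moment of X_{t+1} - X_t by
   K / n_t, which is summable in t as soon as s > 0; the conditional bias is of
   order n_t^(-rho), which is summable iff (1 + s) rho > 1.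
   - If it is summable, E (1 + (X_t - X_0)^2) grows at each step by a factor at
     most 1 + beta_t + K / n_t, so that E (X_T - X_0)^2 <= exp (G n) - 1
     uniformly in T, with G n --> 0.
   - Otherwise let B_T be the diverging sum of the lower bounds on the biases and
     eps their common sign. The expectation of the squared lag
     (max (0, B_T - eps (X_T - X_0)))^2 grows at each step by at most K / n_t,
     hence stays bounded in T, while it is at least (B_T - delta)^2 on the event
     |X_T - X_0| < delta.
   Both recursions only use that the law of the t-th dataset is the mixture of the
   product laws given by theta_hat t. *)
From HB Require Import structures.
Require Import Defs.
From mathcomp Require Import all_boot all_order all_algebra.
From mathcomp Require Import all_classical all_reals all_analysis.
From mathcomp Require Import measurable_realfun.
From mathcomp Require Import ring lra.

Set Implicit Arguments.
Unset Strict Implicit.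
Unset Printing Implicit Defensive.

Local Open Scope classical_set_scope.
Local Open Scope ring_scope.

(** * Partial sums of the Riemann series *)

(** Write [v = t + 1] and [w = t + 2]. Multiplied by [e w^e], the claim becomes
    [1 + e / w <= (w / v)^e]; the right-hand side is at least [1 + e ln (w / v)], and
    [ln (w / v) = - ln (1 - 1 / w) >= 1 / w]. *)
Lemma riemannR_le_telescope (R : realType) (e : R) (t : nat) : 0 < e ->
  riemannR (1 + e) t.+1 <= e^-1 * (riemannR e t - riemannR e t.+1).
Proof.
move=> e0; rewrite /riemannR.
have w0 : 0 < t.+2%:R :> R by [].
have v0 : 0 < t.+1%:R :> R by [].
have w0' : t.+2%:R != 0 :> R by rewrite gt_eqF.
have v0' : t.+1%:R != 0 :> R by rewrite gt_eqF.
rewrite ler_pdivlMl// powRD ?w0' ?implybT// powRr1 ?ler0n//.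
set p := t.+2%:R `^ e; have p0 : 0 < p by rewrite powR_gt0.
suff H : 1 + e / t.+2%:R <= p / t.+1%:R `^ e.
  rewrite -(ler_pM2l p0); apply: le_trans (_ : e / t.+2%:R <= _).
    by rewrite invfM mulrCA [p * _]mulrCA divff ?gt_eqF// mulr1.
  by rewrite mulrBr divff ?gt_eqF// lerBrDr addrC.
rewrite /p /powR (negbTE w0') (negbTE v0') -expRN -expRD.
apply: le_trans (expR_ge1Dx _); rewrite lerD2l -mulrN -mulrDr ler_pM2l//.
rewrite -lnV ?posrE// -lnM ?posrE ?invr_gt0//.
rewrite -[X in ln X]invrK lnV ?posrE ?invr_gt0 ?mulr_gt0 ?invr_gt0//.
rewrite lerNr -[X in ln X](_ : 1 + (- t.+2%:R^-1) = _); last first.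
  by rewrite invfM invrK; field; rewrite -!natr1 in w0' v0' *; lra.
by apply: le_ln1Dx; rewrite ltrN2 invf_lt1// ltr1n.
Qed.

Lemma sum_riemannR_le (R : realType) (a : R) (T : nat) : 1 < a ->
  \sum_(t < T) riemannR a t <= 1 + (a - 1)^-1.
Proof.
move=> a1; have e0 : 0 < a - 1 by rewrite subr_gt0.
have r0 t : 0 < riemannR (a - 1) t by apply: riemannR_gt0; exact: ltW.
(* The term [t = 0], equal to 1, is outside the telescoping bound; the later ones collapse to the
   product on the right. *)
suff H : \sum_(t < T.+1) riemannR a t <=
    1 + (a - 1)^-1 * (1 - riemannR (a - 1) T).
  apply: (@le_trans _ _ (\sum_(t < T.+1) riemannR a t)).
    by rewrite big_ord_recr/= lerDl invr_ge0 powR_ge0.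
  apply: le_trans H _; rewrite lerD2l ler_piMr ?invr_ge0 ?(ltW e0)//.
  by rewrite gerBl ltW.
elim: T => [|T IH].
  by rewrite big_ord1 /riemannR !powR1 invr1 subrr mulr0 addr0.
rewrite big_ord_recr/=; have := @riemannR_le_telescope R _ T e0.
rewrite [1 + _]addrC subrK => H.
apply: le_trans (lerD IH H) _; rewrite -addrA -mulrDr addrA subrK.
exact: lexx.
Qed.

(** * Integration against a mixture of probability laws *)

Section mixture.
Context d d' (Omega : measurableType d) (T : measurableType d') (R : realType).
Variables (Q : probability Omega R) (k : Omega -> probability T R).
Hypothesis mk : forall B, measurable B -> measurable_fun setT (fun w => k w B).

Let cst_ker (x : unit) : {measure set Omega -> \bar R} := Q.

Let measurable_cst_ker U : measurable U ->
  measurable_fun setT (cst_ker ^~ U).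
Proof. by move=> _; exact: measurable_cst. Qed.

HB.instance Definition _ := isKernel.Build _ _ _ _ R cst_ker measurable_cst_ker.

HB.instance Definition _ := Kernel_isProbability.Build _ _ _ _ R cst_ker
  (fun=> probability_setT Q).

Let snd_ker (x : unit * Omega) : {measure set T -> \bar R} := k x.2.

Let measurable_snd_ker U : measurable U ->
  measurable_fun setT (snd_ker ^~ U).
Proof.
move=> mU; apply: (@measurableT_comp _ _ _ _ _ _ (fun w => k w U) _ snd).
  exact: mk.
exact: measurable_snd.
Qed.

HB.instance Definition _ := isKernel.Build _ _ _ _ R snd_ker measurable_snd_ker.

HB.instance Definition _ := Kernel_isProbability.Build _ _ _ _ R snd_ker
  (fun x => probability_setT (k x.2)).

(** The hypothesis on the law of [D] says that the image of [Q] under [D] is the composition of two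
    kernels: [Q], as a constant kernel out of [unit], then [k]. Integration against a composition is
    iterated integration. *)
Lemma ge0_integral_mixture (D : Omega -> T) (f : T -> \bar R) :
  measurable_fun setT D ->
  (forall B, measurable B -> Q (D @^-1` B) = (\int[Q]_w k w B)%E) ->
  measurable_fun setT f -> (forall x, 0 <= f x)%E ->
  (\int[Q]_w f (D w) = \int[Q]_w \int[k w]_x f x)%E.
Proof.
move=> mD lawD mf f0.
rewrite -(@integral_kcomp _ _ _ _ _ _ _ cst_ker snd_ker tt f f0 mf).
transitivity (\int[pushforward Q D]_x f x)%E.
  by rewrite ge0_integral_pushforward// => y _.
apply: eq_measure_integral => A mA _.
exact: lawD.
Qed.

End mixture.

(** * Second moments from tail bounds *)

Section second_moment.
Context d (T : measurableType d) (R : realType) (mu : probability T R).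

Lemma ge0_nneseries_le (u : nat -> \bar R) (l : \bar R) :
  (forall k, 0 <= u k)%E -> (forall n, \sum_(k < n) u k <= l)%E ->
  (\sum_(0 <= k <oo) u k <= l)%E.
Proof.
move=> u0 ul; apply: lime_le; first exact: is_cvg_nneseries.
by apply: nearW => n; rewrite big_mkord.
Qed.

Lemma second_moment_le (Z : T -> R) (a K : R) :
  measurable_fun setT Z -> 0 < a -> 0 <= K ->
  (forall k : nat,
    mu [set x | (k%:R * a <= `|Z x|)%R] <= (K / k.+1%:R ^+ 4)%:E)%E ->
  (\int[mu]_x ((Z x) ^+ 2)%:E <= (a ^+ 2 * (K * 2))%:E)%E.
Proof.
move=> mZ a0 K0 tail.
(* Z^2 <= \sum_k ((k + 1) a)^2 1_{k a <= |Z|}, as the term k = floor (|Z| / a)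
   alone dominates. *)
pose A k := [set x | k%:R * a <= `|Z x|].
have mA k : measurable (A k).
  rewrite -[A k]setTI; apply: measurable_fun_le => //.
  exact: measurableT_comp.
pose f k x := (((k.+1%:R * a) ^+ 2) * \1_(A k) x)%:E : \bar R.
have f0 k x : (0 <= f k x)%E by rewrite lee_fin mulr_ge0 ?sqr_ge0.
have mf k : measurable_fun setT (f k).
  by apply/measurable_EFinP; apply: measurable_funM => //.
apply: (@le_trans _ _ (\int[mu]_x (\sum_(0 <= k <oo) f k x))%E).
  apply: ge0_le_integral => //.
  - by move=> x _; rewrite lee_fin sqr_ge0.
  - by apply/measurable_EFinP; exact: measurable_funX.
  - by apply: ge0_emeasurable_sum => //.
  - move=> x _; pose k := Num.truncn (`|Z x| / a).
    have /andP[lek ltk] : k%:R <= `|Z x| / a < k.+1%:R.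
      by apply: truncn_itv; rewrite divr_ge0// ltW.
    apply: (@le_trans _ _ (f k x)).
      rewrite /f indicE mem_set; last by rewrite /A/= -ler_pdivlMr.
      rewrite mulr1 lee_fin -[leLHS]ger0_norm ?sqr_ge0// normrX.
      by rewrite lerXn2r ?nnegrE ?mulr_ge0 ?(ltW a0)// -ler_pdivrMr// ltW.
    apply: le_trans (_ : (\sum_(0 <= i < k.+1) f i x <= _)%E); last first.
      exact: nneseries_lim_ge.
    rewrite big_mkord big_ord_recr/= leeDr//.
    by apply: sume_ge0.
rewrite integral_nneseries//.
apply: ge0_nneseries_le.
  by move=> k; exact: integral_ge0.
(* The weight [(k + 1)^2] turns the tail [K / (k + 1)^4] into [K / (k + 1)^2], whose partial sums
   are at most [K (1 + (2 - 1)^-1) = K 2]. *)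
move=> n; apply: (@le_trans _ _ 
  (\sum_(k < n) (a ^+ 2 * (K * riemannR 2 k))%:E)%E).
  apply: lee_sum => k _; rewrite /f.
  under eq_integral do rewrite EFinM.
  rewrite ge0_integralZl_EFin ?sqr_ge0//; last exact/measurable_EFinP.
  rewrite integral_indic// setIT.
  apply: le_trans (lee_wpmul2l _ (tail k)) _; first by rewrite lee_fin sqr_ge0.
  rewrite -EFinM lee_fin /riemannR powR_mulrn// le_eqVlt; apply/orP; left.
  by apply/eqP; field; rewrite nat1r pnatr_eq0.
rewrite sumEFin lee_fin -mulr_sumr -mulr_sumr.
rewrite ler_wpM2l ?sqr_ge0// ler_wpM2l//.
apply: le_trans (@sum_riemannR_le R 2 n _) _; first by rewrite ltr1n.
by rewrite (_ : 2 - 1 = 1) ?invr1//; ring.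
Qed.

End second_moment.
(** Turns the exponential of the tail assumption into the decay that [second_moment_le] asks for,
    through [exp x >= x^j / j!] with [j gamma > 4]. *)
Lemma expR_powR_le (R : realType) (C gamma : R) : 0 < C -> 0 < gamma ->
  exists2 K : R, 1 <= K & forall k : nat,
    expR (- (C * k%:R `^ gamma)) <= K / k.+1%:R ^+ 4.
Proof.
move=> C0 g0; pose N := (Num.truncn (4 / gamma)).
have ltN : 4 < N.+1%:R * gamma.
  rewrite -ltr_pdivrMr//.
  by have /andP[] := @truncn_itv R (4 / gamma) (divr_ge0 (ler0n _ _) (ltW g0)).
(* The factor [16 = 2^4] comes from [k + 2 <= 2 (k + 1)]. The summand 1 in the witness [1 + F]
   covers [k = 0], where the exponential is 1. *)
pose F : R := N.+1`!%:R * 16 / C ^+ N.+1.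
have F0 : 0 <= F by rewrite /F divr_ge0 ?mulr_ge0 ?exprn_ge0// ltW.
exists (1 + F); first by rewrite lerDl.
case=> [|k].
  by rewrite powR0 ?gt_eqF// mulr0 oppr0 expR0 expr1n divr1 lerDl.
have k0 : 0 < k.+1%:R :> R by [].
have k1 : 1 <= k.+1%:R :> R by rewrite ler1n.
have x0 : 0 <= C * k.+1%:R `^ gamma by rewrite mulr_ge0 ?powR_ge0// ltW.
have H : C ^+ N.+1 * k.+1%:R ^+ 4 / N.+1`!%:R <= expR (C * k.+1%:R `^ gamma).
  apply: le_trans (expR_ge1Dxn N x0).
  apply: le_trans (_ : (C * k.+1%:R `^ gamma) ^+ N.+1 / N.+1`!%:R <= _);
    last by rewrite lerDr.
  rewrite ler_pM2r ?invr_gt0 ?ltr0n ?fact_gt0//.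
  rewrite exprMn ler_pM2l ?exprn_gt0//.
  rewrite -[leRHS]powR_mulrn ?powR_ge0// -powRrM -powR_mulrn ?ler0n//.
  by rewrite ler_powR// mulrC ltW.
apply: le_trans (_ : F / k.+2%:R ^+ 4 <= _); last first.
  by rewrite ler_pM2r ?invr_gt0 ?exprn_gt0// lerDr.
have D0 : 0 < C ^+ N.+1 * k.+1%:R ^+ 4 / N.+1`!%:R.
  by rewrite !mulr_gt0 ?exprn_gt0// invr_gt0 ltr0n fact_gt0.
rewrite expRN; apply: le_trans (_ : (C ^+ N.+1 * k.+1%:R ^+ 4 / N.+1`!%:R)^-1 <= _).
  by rewrite lef_pV2 ?posrE ?expR_gt0.
rewrite /F; set f := N.+1`!%:R; have f0 : 0 < f by rewrite ltr0n fact_gt0.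
set c := C ^+ N.+1; have c0 : 0 < c by rewrite exprn_gt0.
rewrite ler_pdivlMr ?exprn_gt0//.
have -> : (c * k.+1%:R ^+ 4 / f)^-1 = f / c / k.+1%:R ^+ 4.
  by field; rewrite !gt_eqF//= nat1r.
rewrite mulrAC ler_pdivrMr ?exprn_gt0//.
have -> : f * 16 / c * k.+1%:R ^+ 4 = f / c * (2 * k.+1%:R) ^+ 4.
  by field; rewrite gt_eqF.
rewrite ler_pM2l ?divr_gt0// lerXn2r ?nnegrE ?mulr_ge0//.
by rewrite -natrM ler_nat mul2n -addnn addSnnS leq_addl.
Qed.

(** * Expectations under a quadratic upper bound *)

Section second_order.
Context d (T : measurableType d) (R : realType) (mu : probability T R).

(** Both recursions integrate a function of this kind, so that only the mean of [Z] and a bound on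
    its second moment enter. The mean is a real number because [|z| <= 1 + z^2]. *)
Lemma integral_le_second_order (Z : T -> R) (v : R) :
  measurable_fun setT Z -> (\int[mu]_x ((Z x) ^+ 2)%:E <= v%:E)%E ->
  exists b : R, [/\ (\int[mu]_x (Z x)%:E = b%:E)%E,
    mu.-integrable setT (EFin \o Z) &
    forall (h : T -> R) (A B : R),
      measurable_fun setT h -> (forall x, 0 <= h x) ->
      (forall x, h x <= A + B * Z x + Z x ^+ 2) ->
      (\int[mu]_x (h x)%:E <= (A + B * b + v)%:E)%E].
Proof.
move=> mZ Z2.
have iZ2 : mu.-integrable setT (EFin \o (fun x => Z x ^+ 2)).
  apply/integrableP; split; first by apply/measurable_EFinP; exact: measurable_funX.
  under eq_integral do rewrite /= ger0_norm ?sqr_ge0//.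
  by apply: le_lt_trans Z2 _; rewrite ltry.
have ic r : mu.-integrable setT (EFin \o cst r).
  exact: finite_measure_integrable_cst.
have iZ : mu.-integrable setT (EFin \o Z).
  apply: (@le_integrable _ _ _ mu setT measurableT _
    (EFin \o (fun x => 1 + Z x ^+ 2))).
  - exact/measurable_EFinP.
  - move=> x _ /=; rewrite lee_fin [leRHS]ger0_norm ?addr_ge0 ?sqr_ge0//.
    rewrite -[Z x ^+ 2]real_normK ?num_real//.
    by have := sqr_ge0 (`|Z x| - 1); have := normr_ge0 (Z x); nra.
  - exact: (integrableD measurableT (ic 1) iZ2).
have fZ := integrable_fin_num measurableT iZ.
exists (fine (\int[mu]_x (Z x)%:E)%E); rewrite fineK//; split => //.
move=> h A B mh h0 hle.
have iBZ : mu.-integrable setT (fun x => B%:E * (Z x)%:E)%E.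
  exact: integrableZl.
apply: (@le_trans _ _ (\int[mu]_x ((A%:E + B%:E * (Z x)%:E) + (Z x ^+ 2)%:E))%E).
  apply: ge0_le_integral => //.
  - by move=> x _; rewrite lee_fin.
  - exact/measurable_EFinP.
  - apply/measurable_EFinP; apply: measurable_funD; last exact: measurable_funX.
    by apply: measurable_funD => //; exact: measurable_funM.
  - by move=> x _; rewrite -EFinM -!EFinD lee_fin.
rewrite integralD//; last exact: (integrableD measurableT (ic A) iBZ).
rewrite integralD//; last exact: ic.
rewrite integralZl//.
rewrite EFinD EFinD EFinM fineK// leeD//.
by rewrite integral_cst//= [mu _]probability_setT mule1.
Qed.

End second_order.

(** * The estimator: norm, second moment and bias *)

Section l2norm.
Context (R : realType) (p : nat).

Lemma ler_norm_l2norm (v : 'rV[R]_p) i : `|v ord0 i| <= l2norm v.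
Proof.
rewrite -sqrtr_sqr; apply: ler_wsqrtr.
by rewrite (bigD1 i)//= lerDl sumr_ge0// => j _; exact: sqr_ge0.
Qed.

Lemma measurable_l2normB d (T : measurableType d) (f : T -> 'rV[R]_p)
    (theta : 'rV[R]_p) :
  (forall i, measurable_fun setT (fun x => f x ord0 i)) ->
  measurable_fun setT (fun x => l2norm (f x - theta)).
Proof.
move=> mf; apply: (@measurableT_comp _ _ _ _ _ _ (@Num.sqrt R) _
    (fun x => \sum_(i < p) (f x - theta) ord0 i ^+ 2)).
  by apply: continuous_measurable_fun; exact: sqrt_continuous.
apply: measurable_sum => i; apply: measurable_funX.
under eq_fun do rewrite !mxE.
by apply: measurable_funB => //.
Qed.

End l2norm.

Section estimator.
Context (R : realType) (p : nat) (dX : measure_display) (X : measurableType dX).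
Variables (Theta : set 'rV[R]_p) (P : 'rV[R]_p -> probability X R)
  (M : seq X -> 'rV[R]_p) (C1 C2 gamma kappa : R).
Hypotheses (M_scheme : estimation_scheme Theta M)
  (M_tail : uniform_tail Theta P M C1 C2 gamma (fun n => n%:R `^ kappa))
  (kappa_ge : gamma / 2 <= kappa).

(** At the scale [a = m^(-1/2)], the exponent of the tail at [k a] is
    [C2 m^(kappa - gamma / 2) k^gamma], at least [C2 k^gamma] by [kappa_ge]. The tail in [k] is thus
    bounded independently of [m], and the second moment is of order [a^2 = 1 / m]. *)
Lemma estimator_second_moment : exists2 K : R, 0 <= K &
  forall theta m i, Theta theta -> (0 < m)%N ->
    (\int[iid (P theta) m]_D ((M D ord0 i - theta ord0 i) ^+ 2)%:E
      <= (K / m%:R)%:E)%E.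
Proof.
have [[C10 C20 g0] [_ _ tail]] := M_tail.
have [mThetaM mM] := M_scheme.
have [K K1 expK] := expR_powR_le C20 g0.
have K0 : 0 <= K by apply: le_trans K1.
exists ((1 + C1) * K * 2) => [|theta m i Ttheta m0].
  by rewrite !mulr_ge0// addr_ge0// ltW.
have mR : 0 < m%:R :> R by rewrite ltr0n.
pose a : R := m%:R `^ (- 2^-1).
have a0 : 0 < a by rewrite powR_gt0.
have a2 : a ^+ 2 = m%:R^-1.
  by rewrite -powR_mulrn ?powR_ge0// -powRrM mulNr mulVf// powR_inv1// ltW.
rewrite mulrC -a2; apply: second_moment_le => //.
- by apply: measurable_funB => //; exact: mM.
- by rewrite mulr_ge0// addr_ge0// ltW.
(* At [k = 0] the deviation [k a] vanishes and the tail assumption does not apply; the trivial bound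
   [1 <= (1 + C1) K] replaces it. *)
move=> k; have [->|k0] := posnP k.
  apply: le_trans (probability_le1 _ _) _.
    rewrite -[X in measurable X]setTI; apply: measurable_fun_le => //.
    apply: measurableT_comp => //; apply: measurable_funB => //; exact: mM.
  rewrite expr1n divr1 lee_fin -[leLHS]mul1r ler_pM// lerDl ltW//.
apply: (@le_trans _ _ (iid (P theta) m
    [set D : m.-tuple X | k%:R * a <= l2norm (M D - theta)])).
  apply: le_measure; rewrite ?inE.
  - rewrite -[X in measurable X]setTI; apply: measurable_fun_le => //.
    apply: measurableT_comp => //; apply: measurable_funB => //; exact: mM.
  - rewrite -[X in measurable X]setTI; apply: measurable_fun_le => //.
    by apply: measurable_l2normB => j; exact: mM.
  - move=> D /= /le_trans; apply.
    by have := ler_norm_l2norm (M D - theta) i; rewrite !mxE.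
have ka0 : 0 < k%:R * a by rewrite mulr_gt0// ltr0n.
apply: le_trans (le_trans _ (tail m (k%:R * a) m0 ka0)) _.
  by apply: ereal_sup_ubound; exists theta.
rewrite lee_fin -[leRHS]mulrA ler_pM ?expR_ge0 ?(ltW C10)//.
  by rewrite lerDr.
apply: le_trans (expK k); rewrite ler_expR lerN2 -mulrA ler_pM2l//.
rewrite powRM ?ler0n ?(ltW a0)// mulrCA ler_peMr ?powR_ge0//.
rewrite /a -powRrM -powRD ?pnatr_eq0 -?lt0n ?m0 ?implybT//.
rewrite -[leLHS](powRr0 m%:R) ler_powR ?ler1n//.
by rewrite mulNr subr_ge0 mulrC.
Qed.

End estimator.
Section bias_second_order.
Context (R : realType) (p : nat) (dX : measure_display) (X : measurableType dX).
Variables (P : 'rV[R]_p -> probability X R) (M : seq X -> 'rV[R]_p).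

Lemma bias_second_order (theta : 'rV[R]_p) (m : nat) (i : 'I_p) (v : R) :
  measurable_fun setT (fun D : m.-tuple X => M D ord0 i) ->
  (\int[iid (P theta) m]_D ((M D ord0 i - theta ord0 i) ^+ 2)%:E <= v%:E)%E ->
  exists b : R, bias P M theta m i = b%:E /\
    forall (h : R -> R) (A B : R),
      measurable_fun setT h -> (forall x, 0 <= h x) ->
      (forall x, h x <= A + B * (x - theta ord0 i) + (x - theta ord0 i) ^+ 2) ->
      (\int[iid (P theta) m]_D (h (M D ord0 i))%:E <= (A + B * b + v)%:E)%E.
Proof.
move=> mM Z2.
have mZ : measurable_fun setT
    (fun D : m.-tuple X => M D ord0 i - theta ord0 i).
  by apply: measurable_funB.
have [b [Eb iZ hb]] := integral_le_second_order mZ Z2.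
exists b; split; last first.
  move=> h A B mh h0 hle; apply: hb => //.
  exact: (measurableT_comp mh mM).
rewrite /bias unlock.
have -> : (\int[iid (P theta) m]_D (M D ord0 i)%:E =
    \int[iid (P theta) m]_D
      ((M D ord0 i - theta ord0 i)%:E + (theta ord0 i)%:E))%E.
  by apply: eq_integral => D _; rewrite -EFinD subrK.
rewrite integralD//; last exact: finite_measure_integrable_cst.
rewrite Eb integral_cst//= [iid _ _ _]probability_setT mule1.
by rewrite -!EFinD addrK.
Qed.

End bias_second_order.

(** * One step of training and the two moment recursions *)

Section training.
Context (R : realType) (p : nat) (dX : measure_display) (X : measurableType dX).
Variables (Theta : set 'rV[R]_p) (P : 'rV[R]_p -> probability X R)
  (M : seq X -> 'rV[R]_p) (theta_star : 'rV[R]_p).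
Context (d : measure_display) (Omega : measurableType d)
  (Q : probability Omega R).
Variables (size : nat -> nat) (D : forall t : nat, Omega -> (size t).-tuple X).
Hypotheses (M_scheme : estimation_scheme Theta M)
  (theta_star_in : Theta theta_star)
  (D_training : recursive_training P M theta_star Q D).

Local Notation hat := (theta_hat M theta_star D).

Lemma theta_hat_in t w : Theta (hat t w).
Proof. by have [MT _] := M_scheme; case: t => [|t]; [|exact: MT]. Qed.

Lemma measurable_theta_hat t i : measurable_fun setT (fun w => hat t w ord0 i).
Proof.
have [mD _] := D_training; have [_ mM] := M_scheme.
case: t => [|t]; first exact: measurable_cst.
exact: (measurableT_comp (mM _ i) (mD t)).
Qed.

Lemma past_measurable t A : past D t A -> measurable A.
Proof.
have [mD _] := D_training.
apply: smallest_sub; first exact: sigma_algebra_measurable.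
move=> _ [u [B [_ mB ->]]]; rewrite -[X in measurable X]setTI.
exact: mD.
Qed.

(** Taking the whole space as conditioning event exhibits the law of [D t] as the mixture of the
    laws [iid (P (hat t w)) (size t)]. *)
Lemma ge0_integral_step t (f : (size t).-tuple X -> \bar R) :
  measurable_fun setT f -> (forall x, 0 <= f x)%E ->
  (\int[Q]_w f (D t w) =
    \int[Q]_w \int[iid (P (hat t w)) (size t)]_x f x)%E.
Proof.
move=> mf f0; have [mD cD] := D_training.
apply: ge0_integral_mixture => //.
- move=> B mB _ Y mY; rewrite setTI; apply: (@past_measurable t).
  exact: (cD t B mB).1.
- exact: mD.
- move=> B mB; have [mk lawk] := cD t B mB.
  by rewrite -[D t @^-1` B]setTI -lawk// -(preimage_setT
    (fun w => iid (P (hat t w)) (size t) B)); exact: mk.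
Qed.

(** Carries a bound for fixed parameters over to the random parameter [hat t], all of whose values
    lie in [Theta]. *)
Lemma le_integral_step t i (f g : R -> R) :
  measurable_fun setT f -> (forall x, 0 <= f x) -> measurable_fun setT g ->
  (forall theta, Theta theta ->
    \int[iid (P theta) (size t)]_x (f (M x ord0 i))%:E
      <= (g (theta ord0 i))%:E)%E ->
  (\int[Q]_w (f (hat t.+1 w ord0 i))%:E <= \int[Q]_w (g (hat t w ord0 i))%:E)%E.
Proof.
move=> mf f0 mg fg; have [mD cD] := D_training; have [_ mM] := M_scheme.
pose F (x : (size t).-tuple X) := (f (M x ord0 i))%:E.
have mF : measurable_fun setT F.
  by apply/measurable_EFinP; exact: (measurableT_comp mf (mM _ i)).
have F0 x : (0 <= F x)%E by rewrite lee_fin.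
rewrite [leLHS](ge0_integral_step mF F0); apply: ge0_le_integral => //.
- by move=> w _; exact: integral_ge0.
- apply: (@measurable_fun_integral_kernel _ _ _ _ _
    (fun w => iid (P (hat t w)) (size t))) => // B mB _ Y mY.
  by rewrite setTI; apply: (@past_measurable t); exact: (cD t B mB).1.
- by apply/measurable_EFinP; 
  exact: (measurableT_comp mg (measurable_theta_hat t i)).
- by move=> w _; apply: fg; exact: theta_hat_in.
Qed.

Variables (i : 'I_p) (v : nat -> R).
Hypothesis second_moment : forall t theta, Theta theta ->
  (\int[iid (P theta) (size t)]_x ((M x ord0 i - theta ord0 i) ^+ 2)%:E
    <= (v t)%:E)%E.

Lemma second_moment_bound_ge0 t : 0 <= v t.
Proof.
rewrite -lee_fin; apply: le_trans (second_moment t theta_star_in).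
by apply: integral_ge0 => x _; rewrite lee_fin sqr_ge0.
Qed.

Lemma measurable_sqrB (c : R) : measurable_fun setT (fun x : R => (x - c) ^+ 2).
Proof. by apply: measurable_funX; exact: measurable_funB. Qed.

(** The summand 1 absorbs the bias term: from a parameter at signed distance [y] of [c], the next
    expectation is at most [1 + y^2 + 2 y b + v], and [2 y b <= beta (1 + y^2)]. The growth factor
    is then [1 + beta + v <= exp (beta + v)]. *)
Lemma theta_hat_second_moment_le (beta : nat -> R) (T : nat) :
  (forall t theta, Theta theta ->
    (`|bias P M theta (size t) i| <= (beta t)%:E)%E) ->
  (\int[Q]_w (1 + (hat T w ord0 i - theta_star ord0 i) ^+ 2)%:E
    <= (expR (\sum_(t < T) (beta t + v t)))%:E)%E.
Proof.
move=> bias_le; have [_ mM] := M_scheme.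
set c := theta_star ord0 i.
have mf : measurable_fun setT (fun x : R => 1 + (x - c) ^+ 2).
  by apply: measurable_funD => //; exact: measurable_sqrB.
elim: T => [|T IH].
  rewrite big_ord0 expR0/=; under eq_integral do rewrite subrr expr0n addr0.
  by rewrite integral_cst// mul1e probability_le1.
pose r := expR (beta T + v T).
apply: (@le_trans _ _ (\int[Q]_w (r * (1 + (hat T w ord0 i - c) ^+ 2))%:E)%E).
  apply: (le_integral_step (f := fun x => 1 + (x - c) ^+ 2)
    (g := fun x => r * (1 + (x - c) ^+ 2))) => //.
  - by move=> x; rewrite addr_ge0// sqr_ge0.
  - exact: measurable_funM.
  move=> theta Ttheta.
  have [b [Eb hb]] := bias_second_order (mM _ i) (second_moment T Ttheta).
  pose y := theta ord0 i - c.
  apply: le_trans (hb _ (1 + y ^+ 2) (2 * y) mf _ _) _ => [x|x|].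
  - by rewrite addr_ge0// sqr_ge0.
  - by rewrite le_eqVlt; apply/orP; left; apply/eqP; rewrite /y; ring.
  have := bias_le T _ Ttheta; rewrite Eb lee_fin => /ler_normlP[b1 b2].
  have v0 := second_moment_bound_ge0 T.
  rewrite lee_fin -/y.
  apply: le_trans (_ : (1 + (beta T + v T)) * (1 + y ^+ 2) <= _).
    have := sqr_ge0 (y - 1); have := sqr_ge0 (y + 1); have := sqr_ge0 y.
    by nra.
  by rewrite ler_wpM2r ?addr_ge0 ?sqr_ge0// expR_ge1Dx.
under eq_integral do rewrite EFinM.
rewrite ge0_integralZl_EFin ?expR_ge0//; last 2 first.
- by move=> w _; rewrite lee_fin addr_ge0// sqr_ge0.
- by apply/measurable_EFinP; 
  exact: (measurableT_comp mf (measurable_theta_hat T i)).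
apply: le_trans (lee_wpmul2l _ IH) _; first by rewrite lee_fin expR_ge0.
by rewrite -EFinM lee_fin big_ord_recr/= -expRD addrC.
Qed.

(** The positive part is there because only a lower bound on the drift [eps b] is given. At a lag
    [y >= 0] the next expected square is at most [(y + beta)^2 - 2 (y + beta) eps b + v], and
    [eps b >= beta] brings this below [y^2 - beta^2 + v]; at a negative lag a large drift would
    increase the square. *)
Lemma theta_hat_lag_le (eps : R) (beta : nat -> R) (T : nat) :
  eps ^+ 2 = 1 -> (forall t, 0 <= beta t) ->
  (forall t theta, Theta theta ->
    ((beta t)%:E <= eps%:E * bias P M theta (size t) i)%E) ->
  (\int[Q]_w (Num.max 0 (\sum_(t < T) beta t
      - eps * (hat T w ord0 i - theta_star ord0 i)) ^+ 2)%:E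
    <= (\sum_(t < T) v t)%:E)%E.
Proof.
move=> eps2 beta0 le_bias; have [_ mM] := M_scheme.
set c := theta_star ord0 i.
pose f (b x : R) : R := Num.max 0 (b - eps * (x - c)) ^+ 2.
have mf b : measurable_fun setT (f b).
  apply: measurable_funX; apply: measurable_maxr => //.
  apply: measurable_funB => //; apply: measurable_funM => //.
  exact: measurable_funB.
have f0 b x : 0 <= f b x by exact: sqr_ge0.
elim: T => [|T IH].
  rewrite !big_ord0; under eq_integral do
    rewrite subrr mulr0 subrr maxxx expr0n.
  by rewrite integral0.
rewrite !big_ord_recr/=; set b := (\sum_(t < T) beta t).
apply: (@le_trans _ _ (\int[Q]_w (f b (hat T w ord0 i) + v T)%:E)%E).
  apply: (le_integral_step (f := f (b + beta T)) 
    (g := fun x => f b x + v T)) => //.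
    by apply: measurable_funD.
  move=> theta Ttheta.
  have [m [Em hm]] := bias_second_order (mM _ i) (second_moment T Ttheta).
  have := le_bias T _ Ttheta; rewrite Em -EFinM lee_fin => betam.
  pose y := Num.max 0 (b - eps * (theta ord0 i - c)).
  have y0 : 0 <= y by rewrite le_max lexx.
  have yb : b - eps * (theta ord0 i - c) <= y by rewrite le_max lexx orbT.
  apply: le_trans (hm _ (y ^+ 2 + 2 * y * beta T + beta T ^+ 2)
    (- (2 * eps * (y + beta T))) (mf _) (f0 _) _) _ => [x|].
    rewrite /f.
    (* Both 0 and the new lag are at most the absolute value of the base of this square, as [y]
       dominates the old lag. *)
    apply: le_trans
      (_ : (y + (beta T - eps * (x - theta ord0 i))) ^+ 2 <= _).
      rewrite -[leRHS]real_normK ?num_real// lerXn2r ?nnegrE ?le_max ?lexx//.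
      rewrite ge_max normr_ge0/=; apply: le_trans (ler_norm _).
      by have := yb; lra.
    (* The last summand vanishes since [eps ^+ 2 = 1]; with it the equality is a polynomial
       identity. *)
    suff -> : (y + (beta T - eps * (x - theta ord0 i))) ^+ 2 =
        y ^+ 2 + 2 * y * beta T + beta T ^+ 2
        + - (2 * eps * (y + beta T)) * (x - theta ord0 i)
        + (x - theta ord0 i) ^+ 2 + (eps ^+ 2 - 1) * (x - theta ord0 i) ^+ 2.
      by rewrite eps2 subrr mul0r addr0.
    by ring.
  rewrite lee_fin lerD2r /f -/y; have := beta0 T; nra.
under eq_integral do rewrite EFinD.
rewrite ge0_integralD//; first last.
- by move=> w _; rewrite lee_fin second_moment_bound_ge0.
- by apply/measurable_EFinP; 
  exact: (measurableT_comp (mf b) (measurable_theta_hat T i)).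
- by move=> w _; rewrite lee_fin.
by rewrite integral_cst//= [Q _]probability_setT mule1 EFinD leeD2r.
Qed.

End training.

(** * Markov's inequality and vanishing negative powers *)

Lemma ge0_markov d (T : measurableType d) (R : realType) (mu : probability T R)
    (g : T -> R) (E : set T) (c : R) :
  measurable_fun setT g -> (forall x, 0 <= g x) -> measurable E -> 0 <= c ->
  (forall x, E x -> c <= g x) -> (c%:E * mu E <= \int[mu]_x (g x)%:E)%E.
Proof.
move=> mg g0 mE c0 cg; rewrite -integral_cst//.
apply: (@le_trans _ _ (\int[mu]_(x in E) (g x)%:E)%E).
  apply: ge0_le_integral => //.
  - by apply/measurable_EFinP; exact: measurable_funS mg.
apply: ge0_subset_integral => //; first exact/measurable_EFinP.
by move=> x _; rewrite lee_fin.
Qed.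

Lemma cvg_powR_natV (R : realType) (a : R) : 0 < a ->
  (n%:R `^ a)^-1 @[n --> \oo] --> (0 : R).
Proof.
move=> a0; apply/gtr0_cvgV0.
  by near=> n; apply: powR_gt0; rewrite ltr0n; near: n; exact: nbhs_infty_gt.
apply/cvgryPge => A; near=> n.
have nA : Num.max A 0 `^ a^-1 <= n%:R by near: n; exact: nbhs_infty_ger.
have M0 : 0 <= Num.max A 0 by rewrite le_max lexx orbT.
apply: (@le_trans _ _ (Num.max A 0)); first by rewrite le_max lexx.
rewrite -[leLHS]powRr1// -[X in _ `^ X <= _](mulVf (lt0r_neq0 a0)) powRrM.
by apply: ge0_ler_powR => //; rewrite ?nnegrE ?powR_ge0 ?ler0n// ltW.
Unshelve. all: by end_near. Qed.

(** * Sample sizes under the power schedule *)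

Section sample_size.
Context (R : realType) (s : R) (n : nat).
Hypotheses (s0 : 0 < s) (n0 : (0 < n)%N).

Let s1 : 0 <= 1 + s. Proof. by rewrite addr_ge0// ltW. Qed.

Let one_powR : 1 `^ (1 + s) = 1 :> R. Proof. by rewrite powR1. Qed.

Lemma sample_sizeS t :
  (sample_size n (power_schedule s) t.+1)%:R
  = (Num.ceil (t.+1%:R `^ (1 + s) * n%:R))%:~R :> R.
Proof.
by rewrite natr_absz ger0_norm// ceil_ge0 (lt_le_trans (ltrN10 _))//
  mulr_ge0// powR_ge0.
Qed.

(** For [t >= 1] this rests on [(t + 1) / 2 <= t]. The shift to [t + 1] includes [t = 0], where the
    size is [n], and matches the indexing of [riemannR]. *)
Lemma le_sample_size t :
  (t.+1%:R / 2) `^ (1 + s) * n%:R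
  <= (sample_size n (power_schedule s) t)%:R :> R.
Proof.
have h0 k : 0 <= k%:R / 2 :> R by rewrite divr_ge0.
case: t => [|t].
  rewrite ler_piMl// -[leRHS]one_powR ge0_ler_powR ?nnegrE//.
  by rewrite ler_pdivrMr// mul1r ler1n.
rewrite sample_sizeS; apply: le_trans (ceil_ge _).
rewrite ler_wpM2r// ge0_ler_powR ?nnegrE// ler_pdivrMr//.
by rewrite -natrM ler_nat muln2 -addnn addSnnS leq_addl.
Qed.

(** Rounding up adds at most 1, which is at most the product being rounded: hence the factor 2. *)
Lemma sample_size_le t :
  (sample_size n (power_schedule s) t)%:R <= 2 * n%:R * t.+1%:R `^ (1 + s) :> R.
Proof.
have n1 : 1 <= n%:R :> R by rewrite ler1n.
case: t => [|t].
  by rewrite powR1 mulr1 mulr_natl mulr2n lerDl.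
rewrite sample_sizeS.
apply: (@le_trans _ _ (t.+1%:R `^ (1 + s) * n%:R + 1)).
  have /andP[+ _] := ceil_itv (t.+1%:R `^ (1 + s) * n%:R : R).
  by rewrite intrB ltrBlDr => /ltW.
have t1 : 1 <= t.+1%:R `^ (1 + s) :> R.
  by rewrite -[leLHS]one_powR ge0_ler_powR ?nnegrE// ler1n.
apply: (@le_trans _ _ (2 * n%:R * t.+1%:R `^ (1 + s))); first by nra.
by rewrite ler_wpM2l ?mulr_ge0// ge0_ler_powR ?nnegrE// ler_nat.
Qed.

Lemma sample_size_gt0 t : (0 < sample_size n (power_schedule s) t)%N.
Proof.
rewrite -(ltr0n R); apply: lt_le_trans (le_sample_size t).
by rewrite mulr_gt0 ?powR_gt0 ?ltr0n// divr_gt0.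
Qed.

Lemma inv_sample_size_powR_le (a : R) t : 0 <= a ->
  ((sample_size n (power_schedule s) t)%:R `^ a)^-1
  <= 2 `^ ((1 + s) * a) * (n%:R `^ a)^-1 * riemannR ((1 + s) * a) t.
Proof.
move=> a0; have nR : 0 < n%:R :> R by rewrite ltr0n.
have tR : 0 < t.+1%:R :> R by [].
have -> : 2 `^ ((1 + s) * a) * (n%:R `^ a)^-1 * riemannR ((1 + s) * a) t
    = (((t.+1%:R / 2) `^ (1 + s) * n%:R) `^ a)^-1.
  rewrite powRM ?powR_ge0 ?(ltW nR)// -powRrM /riemannR.
  rewrite powRM ?invr_ge0 ?(ltW tR)//.
  rewrite -[2^-1]powR_inv1// -[(_ `^ -1) `^ _]powRrM mulN1r powRN.
  by rewrite !invfM invrK mulrC mulrA.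
rewrite lef_pV2 ?posrE ?powR_gt0 ?mulr_gt0 ?powR_gt0 ?divr_gt0 ?ltr0n
  ?sample_size_gt0//.
by rewrite ge0_ler_powR ?nnegrE ?mulr_ge0 ?powR_ge0 ?le_sample_size// ltW.
Qed.

Lemma inv_sample_size_powR_ge (a : R) t : 0 <= a ->
  ((2 * n%:R) `^ a)^-1 * riemannR ((1 + s) * a) t
  <= ((sample_size n (power_schedule s) t)%:R `^ a)^-1.
Proof.
move=> a0; have nR : 0 < n%:R :> R by rewrite ltr0n.
have n2 : 0 <= 2 * n%:R :> R by rewrite mulr_ge0.
rewrite /riemannR -invfM powRrM -powRM ?powR_ge0//.
rewrite lef_pV2 ?posrE ?powR_gt0 ?mulr_gt0 ?powR_gt0 ?ltr0n ?sample_size_gt0//.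
by rewrite ge0_ler_powR ?nnegrE ?mulr_ge0 ?powR_ge0 ?sample_size_le.
Qed.

(** Serves with [a = 1] for the second moments and with [a = rho] for the biases. *)
Lemma sum_inv_sample_size_le (a : R) T : 0 <= a -> 1 < (1 + s) * a ->
  \sum_(t < T) ((sample_size n (power_schedule s) t)%:R `^ a)^-1
  <= 2 `^ ((1 + s) * a) * (1 + ((1 + s) * a - 1)^-1) * (n%:R `^ a)^-1.
Proof.
move=> a0 sa; rewrite mulrAC.
apply: (@le_trans _ _ (\sum_(t < T)
  2 `^ ((1 + s) * a) * (n%:R `^ a)^-1 * riemannR ((1 + s) * a) t)).
  by apply: ler_sum => t _; exact: inv_sample_size_powR_le.
rewrite -mulr_sumr ler_wpM2l ?mulr_ge0 ?invr_ge0 ?powR_ge0//.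
exact: sum_riemannR_le.
Qed.

End sample_size.

(** * From moment bounds to iterated limits *)

Lemma iterated_lim0_le (R : realType) (u : nat -> nat -> \bar R) (U : nat -> R) :
  (forall n T, 0 <= u n T)%E ->
  (forall n T, (0 < n)%N -> (u n T <= (U n)%:E)%E) ->
  U n @[n --> \oo] --> (0 : R) -> iterated_lim0 u.
Proof.
move=> u0 uU U0; rewrite /iterated_lim0.
apply: (@squeeze_cvge _ _ _ _ (cst 0%E) _ (fun n => (U n)%:E)).
- near=> n; have n0 : (0 < n)%N by near: n; exact: nbhs_infty_gt.
  apply/andP; split.
    by apply: limf_esup_ge0 => // -[N _ /(_ N)]; apply => /=.
  rewrite limn_esup_lim; apply: lime_le; first exact: is_cvg_esups.
  by apply: nearW => m; apply: ge_ereal_sup => _ [k _ <-]; exact: uU.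
- exact: cvg_cst.
- by apply: cvg_EFin => //; exact: nearW.
Unshelve. all: by end_near. Qed.

Section power_schedule.
Context (R : realType) (p : nat) (dX : measure_display) (X : measurableType dX).
Variables (Theta : set 'rV[R]_p) (P : 'rV[R]_p -> probability X R)
  (M : seq X -> 'rV[R]_p) (C1 C2 gamma kappa rho : R).
Hypotheses (M_scheme : estimation_scheme Theta M)
  (M_tail : uniform_tail Theta P M C1 C2 gamma (fun n => n%:R `^ kappa))
  (kappa_ge : gamma / 2 <= kappa)
  (M_bias : bias_assumption Theta P M rho).
Variable theta_star : 'rV[R]_p.
Hypothesis theta_star_in : Theta theta_star.
Variables (s : R) (dO : nat -> measure_display)
  (Omega : forall n : nat, measurableType (dO n))
  (Q : forall n : nat, probability (Omega n) R)
  (D : forall n t : nat,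
     Omega n -> (sample_size n (power_schedule s) t).-tuple X).
Hypotheses (D_training : forall n : nat, (0 < n)%N ->
     recursive_training P M theta_star (Q n) (@D n)) (s0 : 0 < s).

Local Notation hat n := (theta_hat M theta_star (@D n)).

Lemma cvg_theta_hat_second_moment (i : 'I_p) : 1 < (1 + s) * rho ->
  exists2 G : nat -> R, G n @[n --> \oo] --> (0 : R) &
    forall n T, (0 < n)%N ->
      (\int[Q n]_w ((hat n T w ord0 i - theta_star ord0 i) ^+ 2)%:E
        <= (G n)%:E)%E.
Proof.
move=> srho; have [rho0 [v [v0 /(_ i)[c [C [/andP[c0 cC] biasC]]]]]] := M_bias.
have [K K0 mom] := estimator_second_moment M_scheme M_tail kappa_ge.
have Cv0 : 0 <= C * v i 
  by rewrite mulr_ge0 ?(ltW (v0 i))// ltW// (lt_le_trans c0).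
(* [A a] is the constant of [sum_inv_sample_size_le], so that [G n] bounds the sums of [beta] and
   [var] below, whatever the number of steps. *)
pose A a := 2 `^ ((1 + s) * a) * (1 + ((1 + s) * a - 1)^-1).
pose G n := C * v i * A rho * (n%:R `^ rho)^-1 + K * A 1 * (n%:R `^ 1)^-1.
have G0 : G n @[n --> \oo] --> (0 : R).
  rewrite -[X in _ --> X](addr0 0) /G; apply: cvgD.
    rewrite -[X in _ --> X](mulr0 (C * v i * A rho)).
    by apply: cvgM; [exact: cvg_cst|exact: cvg_powR_natV].
  rewrite -[X in _ --> X](mulr0 (K * A 1)).
  by apply: cvgM; [exact: cvg_cst|exact: cvg_powR_natV].
exists (fun n => expR (G n) - 1).
  rewrite -[X in _ --> X](subrr 1) -[X in _ --> X - _]expR0.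
  apply: cvgB; last exact: cvg_cst.
  exact: (cvg_comp _ _ G0 (@continuous_expR R 0)).
move=> n T n0.
pose m t := sample_size n (power_schedule s) t.
pose var t := K * ((m t)%:R `^ 1)^-1.
pose beta t := C * v i * ((m t)%:R `^ rho)^-1.
have mm t theta : Theta theta ->
    (\int[iid (P theta) (m t)]_x ((M x ord0 i - theta ord0 i) ^+ 2)%:E
      <= (var t)%:E)%E.
  move=> Ttheta; rewrite /var powRr1//; apply: mom => //.
  exact: (@sample_size_gt0 R).
have bb t theta : Theta theta ->
    (`|bias P M theta (m t) i| <= (beta t)%:E)%E.
  move=> Ttheta; rewrite /beta -mulrA.
  by have /andP[] := biasC theta (m t) Ttheta (sample_size_gt0 s0 n0 t).
have := theta_hat_second_moment_le M_scheme theta_star_in (D_training n0) mm T bb.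
have mX : measurable_fun setT
    (fun w => (hat n T w ord0 i - theta_star ord0 i) ^+ 2).
  apply: measurable_funX; apply: measurable_funB => //.
  exact: (measurable_theta_hat M_scheme (D_training n0)).
under eq_integral do rewrite EFinD.
rewrite ge0_integralD//; last 2 first.
- by move=> w _; rewrite lee_fin sqr_ge0.
- exact/measurable_EFinP.
rewrite integral_cst//= [Q n _]probability_setT mule1 => H.
rewrite EFinB leeBrDl//; apply: le_trans H _.
rewrite lee_fin ler_expR big_split/= -!mulr_sumr /G
  -[X in _ <= X + _]mulrA -[X in _ <= _ + X]mulrA.
rewrite lerD// ler_wpM2l// sum_inv_sample_size_le//; first exact: ltW.
by rewrite mulr1 ltrDl.
Qed.

Local Notation err delta n T :=
  (Q n [set w | delta <= l2norm (hat n T w - theta_star)]).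

Lemma measurable_err (delta : R) n T : (0 < n)%N ->
  measurable [set w | delta <= l2norm (hat n T w - theta_star)].
Proof.
move=> n0; rewrite -[X in measurable X]setTI; apply: measurable_fun_le => //.
apply: measurable_l2normB => i.
exact: (measurable_theta_hat M_scheme (D_training n0)).
Qed.

(** Markov's inequality for the squared norm, whose expectation is the sum of the second moments of
    the coordinates. *)
Lemma iterated_lim0_err (delta : R) : 0 < delta -> 1 < (1 + s) * rho ->
  iterated_lim0 (fun n T => err delta n T).
Proof.
move=> delta0 srho.
have /choice[G HG] : forall i, exists G : nat -> R,
    G n @[n --> \oo] --> (0 : R) /\ forall n T, (0 < n)%N ->
      (\int[Q n]_w ((hat n T w ord0 i - theta_star ord0 i) ^+ 2)%:E
        <= (G n)%:E)%E.
  by move=> i; have [G] := cvg_theta_hat_second_moment i srho; exists G.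
apply: (@iterated_lim0_le _ _ (fun n => (delta ^+ 2)^-1 * \sum_i G i n)) => //.
  move=> n T n0; have d2 : 0 < delta ^+ 2 by rewrite exprn_gt0.
  rewrite EFinM lee_pdivlMl//.
  have mX i : measurable_fun setT (fun w =>
      (hat n T w ord0 i - theta_star ord0 i) ^+ 2).
    apply: measurable_funX; apply: measurable_funB => //.
    exact: (measurable_theta_hat M_scheme (D_training n0)).
  apply: (@le_trans _ _ (\int[Q n]_w
     (\sum_i (hat n T w ord0 i - theta_star ord0 i) ^+ 2)%:E)%E).
    apply: ge0_markov => //.
    - exact: measurable_sum.
    - by move=> w; apply: sumr_ge0 => i _; exact: sqr_ge0.
    - exact: measurable_err.
    - exact: ltW.
    move=> w /= H.
    rewrite -ler_sqrt ?sumr_ge0//; last by move=> i _; exact: sqr_ge0.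
    rewrite sqrtr_sqr ger0_norm ?(ltW delta0)//.
    suff <- : l2norm (hat n T w - theta_star)
        = Num.sqrt (\sum_i (hat n T w ord0 i - theta_star ord0 i) ^+ 2) by [].
    by congr Num.sqrt; apply: eq_bigr => i _; rewrite !mxE.
  under eq_integral do rewrite -sumEFin.
  rewrite ge0_integral_sum//; last 2 first.
  - by move=> i; exact/measurable_EFinP.
  - by move=> i w _; rewrite lee_fin sqr_ge0.
  by rewrite -sumEFin; apply: lee_sum => i _; exact: (HG i).2.
rewrite -[X in _ --> X](mulr0 (delta ^+ 2)^-1).
apply: cvgM; first exact: cvg_cst.
rewrite -[X in _ --> X](_ : \sum_(i < p) 0 = 0); last by rewrite big1.
by apply: cvg_big => [|i _]; [exact: add_continuous|exact: (HG i).1].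
Qed.

(** For each [n > 0] the inner limit is already 1. An estimate within [delta] of [theta_star] has a
    lag of at least [B T - delta] in coordinate [i], which by Markov's inequality has probability at
    most [S / (B T - delta)^2]. *)
Lemma iterated_lim1_err (delta : R) : 0 < delta -> (1 + s) * rho <= 1 ->
  (exists i : 'I_p, one_signed_bias Theta P M i) ->
  iterated_lim (fun n T => err delta n T) 1%E.
Proof.
move=> delta0 srho [i signed].
have [rho0 [v [v0 /(_ i)[c [C [/andP[c0 cC] biasC]]]]]] := M_bias.
have [K K0 mom] := estimator_second_moment M_scheme M_tail kappa_ge.
exists (cst 1%E); split; last exact: cvg_cst.
near=> n; have n0 : (0 < n)%N by near: n; exact: nbhs_infty_gt.
pose m t := sample_size n (power_schedule s) t.
have m0 t : (0 < m t)%N by exact: sample_size_gt0.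
pose var t := K * ((m t)%:R `^ 1)^-1.
pose beta t := c * v i * ((m t)%:R `^ rho)^-1.
have cv0 : 0 < c * v i by rewrite mulr_gt0.
have beta0 t : 0 <= beta t by rewrite mulr_ge0 ?(ltW cv0)// invr_ge0 powR_ge0.
have mm t theta : Theta theta ->
    (\int[iid (P theta) (m t)]_x ((M x ord0 i - theta ord0 i) ^+ 2)%:E
      <= (var t)%:E)%E.
  by move=> Ttheta; rewrite /var powRr1//; apply: mom.
(* One sign for all [t] and [theta]: the lower bound on the absolute bias becomes a drift in a fixed
   direction, which accumulates. *)
have [eps eps2 le_bias] : exists2 eps : R, eps ^+ 2 = 1 &
    forall t theta, Theta theta ->
      ((beta t)%:E <= eps%:E * bias P M theta (m t) i)%E.
  case: signed => sgn; [exists 1|exists (-1)]; rewrite ?sqrrN ?expr1n//;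
    move=> t theta Ttheta; have := sgn theta (m t) Ttheta (m0 t);
    have /andP[] := biasC theta (m t) Ttheta (m0 t); rewrite /beta -mulrA.
  - by move=> + _ b0; rewrite gee0_abs// mul1e.
  - by move=> + _ b0; rewrite lee0_abs// EFinN mulN1e.
pose B T := \sum_(t < T) beta t.
pose S := K * (2 `^ ((1 + s) * 1) * (1 + ((1 + s) * 1 - 1)^-1)
  * (n%:R `^ 1)^-1).
have S_le T : \sum_(t < T) var t <= S.
  rewrite -mulr_sumr ler_wpM2l// sum_inv_sample_size_le//.
  by rewrite mulr1 ltrDl.
(* Since [(1 + s) rho <= 1], [B] dominates a positive multiple of a divergent Riemann series. *)
have Boo : B T @[T --> \oo] --> +oo.
  pose r := c * v i * ((2 * n%:R) `^ rho)^-1.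
  have r0 : 0 < r.
    by rewrite mulr_gt0// invr_gt0 powR_gt0// mulr_gt0// ltr0n.
  have srho0 : 0 <= (1 + s) * rho by rewrite mulr_ge0 ?addr_ge0// ltW.
  have dvg : series (riemannR ((1 + s) * rho)) T @[T --> \oo] --> +oo.
    apply: nondecreasing_dvgn_lt.
      apply/nondecreasing_seqP => T.
      by rewrite seriesSr lerDl ltW// riemannR_gt0.
    by apply: dvg_riemannR; rewrite srho0.
  apply: (@ger_cvgy _ _ _ _ (fun T => r * series (riemannR ((1 + s) * rho)) T)).
    apply: nearW => T; rewrite /series/= big_mkord mulr_sumr.
    apply: ler_sum => t _; rewrite /r /beta -mulrA ler_pM2l//.
    by apply: inv_sample_size_powR_ge => //; exact: ltW.
  apply/cvgryPge => a; near=> T; rewrite mulrC -ler_pdivrMr//.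
  by near: T; exact: cvgry_ge.
(* The first power of [B T - delta] replaces the square: this weakens the bound once
   [B T - delta >= 1]. *)
pose U T := 1 - S * (B T - delta)^-1.
have S0 : 0 <= S by apply: le_trans (S_le 0%N); rewrite big_ord0.
have Bdoo : B T - delta @[T --> \oo] --> +oo.
  apply/cvgryPge => a; near=> T; rewrite lerBrDr.
  by near: T; exact: cvgry_ge.
apply: (@squeeze_cvge _ _ _ _ (fun T => (U T)%:E) _ (cst 1%E)).
- near=> T; apply/andP; split.
    2: exact: probability_le1 (measurable_err _ _ n0).
  have BT : 1 <= B T - delta by near: T; exact: cvgry_ge.
  have BT0 : 0 < B T - delta by apply: lt_le_trans BT.
  pose A := [set w | delta <= l2norm (hat n T w - theta_star)].
  have mA : measurable A by exact: measurable_err.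
  have := 
    theta_hat_lag_le M_scheme theta_star_in (D_training n0) mm T eps2 beta0
      le_bias.
  set f := fun w : Omega n =>
    Num.max 0 (B T - eps * (hat n T w ord0 i - theta_star ord0 i)) ^+ 2.
  move=> If.
  have mf : measurable_fun setT f.
    apply: measurable_funX; apply: measurable_maxr => //.
    apply: measurable_funB => //; apply: measurable_funM => //.
    apply: measurable_funB => //.
    exact: (measurable_theta_hat M_scheme (D_training n0)).
  have QA : (((B T - delta) ^+ 2)%:E * Q n (~` A) <= S%:E)%E.
    apply: (@le_trans _ _ (\int[Q n]_w (f w)%:E)%E); last first.
      by apply: le_trans If _; rewrite lee_fin.
    apply: ge0_markov => //.
    - by move=> w; exact: sqr_ge0.
    - exact: measurableC.
    - exact: sqr_ge0.
    move=> w /= /negP; rewrite -ltNge => lt_delta.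
    have := le_lt_trans (ler_norm_l2norm _ i) lt_delta.
    rewrite !mxE => /ltW lt_i.
    rewrite lerXn2r ?nnegrE ?(ltW BT0) ?le_max ?lexx//.
    apply/orP; right; rewrite lerD2l lerN2.
    apply: le_trans (ler_norm _) _; rewrite normrM.
    have -> : `|eps| = 1.
      apply/eqP; rewrite -(@eqrXn2 _ 2)// expr1n real_normK ?num_real// eps2//.
    by rewrite mul1r.
  have -> : Q n A = (1 - Q n (~` A))%E.
    by rewrite -{1}(setCK A) probability_setC//; exact: measurableC.
  rewrite /U EFinB leeB//.
  rewrite -lee_pdivlMl ?exprn_gt0// in QA.
  apply: le_trans QA _; rewrite -EFinM lee_fin mulrC ler_wpM2l//.
  rewrite lef_pV2 ?posrE ?exprn_gt0// expr2 ler_peMl// ltW//.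
- apply: cvg_EFin; first exact: nearW.
  have : U T @[T --> \oo] --> (1 - S * 0 : R).
    apply: cvgB; first exact: cvg_cst.
    apply: cvgM; first exact: cvg_cst.
    apply/gtr0_cvgV0 => //.
    by near=> T; rewrite (lt_le_trans ltr01)//; near: T; exact: cvgry_ge.
  by rewrite mulr0 subr0.
- exact: cvg_cst.
Unshelve. all: by end_near. Qed.

End power_schedule.

Theorem theorem4 (R : realType) (p : nat) (p_gt0 : (0 < p)%N)
  (dX : measure_display) (X : measurableType dX)
  (Theta : set 'rV[R]_p) (P : 'rV[R]_p -> probability X R)
  (M : seq X -> 'rV[R]_p) (C1 C2 gamma kappa rho : R)
  (M_scheme : estimation_scheme Theta M)
  (M_tail : uniform_tail Theta P M C1 C2 gamma (fun n => n%:R `^ kappa))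
  (kappa_ge : gamma / 2 <= kappa)
  (M_bias : bias_assumption Theta P M rho)
  (theta_star : 'rV[R]_p) (theta_star_in : Theta theta_star)
  (s : R)
  (dO : nat -> measure_display)
  (Omega : forall n : nat, measurableType (dO n))
  (Q : forall n : nat, probability (Omega n) R)
  (D : forall n t : nat,
     Omega n -> (sample_size n (power_schedule s) t).-tuple X)
  (D_training : forall n : nat, (0 < n)%N ->
     recursive_training P M theta_star (Q n) (D n))
  (delta : R) (delta_gt0 : 0 < delta) :
  let err (n T : nat) : \bar R :=
    Q n [set w | delta <= l2norm (theta_hat M theta_star (D n) T w
                                  - theta_star)] in
  (1 <= rho -> 0 < s -> iterated_lim0 err) /\
  (kappa / gamma <= rho < 1 ->
     (rho^-1 - 1 < s -> iterated_lim0 err) /\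
     (0 < s < rho^-1 - 1 ->
        (exists i : 'I_p, one_signed_bias Theta P M i) ->
        iterated_lim err 1%E)).
Proof.
(* It remains to compare [(1 + s) rho] with 1. It exceeds 1 if [rho >= 1] and [s > 0]; for [rho < 1]
   the threshold is [s = rho^-1 - 1], which is positive. *)
have rho0 : 0 < rho by have [] := M_bias.
split=> [rho1 s0|/andP[_ rho1]].
  apply: (iterated_lim0_err M_scheme M_tail kappa_ge M_bias theta_star_in D_training)
    => //.
  by apply: lt_le_trans (_ : 1 + s <= _); rewrite ?ltrDl//
    ler_peMr// ltW// addr_gt0.
have rhoV : 1 < rho^-1 by rewrite invf_gt1.
split=> [srho|/andP[s0 srho] signed].
  have s0 : 0 < s by apply: lt_trans srho; rewrite subr_gt0.
  apply: (iterated_lim0_err M_scheme M_tail kappa_ge M_bias theta_star_in D_training)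
    => //.
  by rewrite -ltr_pdivrMr// div1r addrC -ltrBlDr.
apply: (iterated_lim1_err M_scheme M_tail kappa_ge M_bias theta_star_in D_training)
  => //.
by rewrite -ler_pdivlMr// div1r addrC -lerBrDr ltW.
Qed.
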